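(* Let $k \ge 4$ and $\ell \ge 1$. Let $G$ be a $k$-$\gamma_c$-critical graph having a maximal complete subgraph $H$ of order at least $2$ such that (a) every vertex of $G$ belongs to some minimum connected dominating set of $G$ that contains a vertex of $H$, and (b) for every pair of non-adjacent vertices $u,v$ of $G$ there is a connected dominating set $D'_{uv}$ of $G+uv$ with $D'_{uv}\cap V(H)\ne\emptyset$ and $|D'_{uv}|<k$. Let $n_1,\dots,n_\ell\ge1$, let $G_1,\dots,G_\ell$ be vertex-disjoint complete graphs with $G_i\cong K_{n_i}$, and let $x_0$ be a new vertex. Let $G^*$ be the graph obtained from the disjoint union of $x_0$, $G_1,\dots,G_\ell$ and $G$ by joining $x_0$ to every vertex of $G_1$, joining every vertex of $G_i$ to every vertex of $G_{i+1}$ for $i\in[\ell-1]$, and joining every vertex of $G_\ell$ to every vertex of $H$. Then $G^*$ is $(k+\ell)$-$\gamma_c$-critical.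
   Context: Graphs are finite and simple. For a connected graph $G$, a connected dominating set is a set $S\subseteq V(G)$ such that every vertex outside $S$ has a neighbor in $S$ and $G[S]$ is connected; $\gamma_c(G)$ is the minimum size of such a set, and a minimum one is a $\gamma_c$-set. A connected graph $G$ is $k$-$\gamma_c$-critical if $\gamma_c(G)=k$ and $\gamma_c(G+uv)<k$ for every pair of non-adjacent vertices $u,v$. *)

(* Defs.v *)
From mathcomp Require Import all_boot.
Set Implicit Arguments.
Unset Strict Implicit.
Unset Printing Implicit Defensive.

Section Graphs.
Variable T : finType.
Implicit Types (e : rel T) (S : {set T}) (u v x y : T).

Definition simple_graph e := symmetric e /\ irreflexive e.

Definition induced e S : rel T := [rel x y | [&& x \in S, y \in S & e x y]].

(* The null graph is not connected. *)
Definition connected_in e S : bool :=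
  (S != set0) && [forall x in S, forall y in S, connect (induced e S) x y].

Definition connected_graph e : bool := connected_in e [set: T].

Definition dominating e S : bool :=
  [forall v, (v \notin S) ==> [exists u in S, e v u]].

Definition is_cds e S : bool := dominating e S && connected_in e S.

(* If e is connected, the default value [set: T] is itself a connected
   dominating set, so this is the minimum (see gamma_cP). *)
Definition gamma_c e : nat :=
  #|[arg min_(S < [set: T] | is_cds e S) #|S|]|.

Definition is_min_cds e S : bool := is_cds e S && (#|S| == gamma_c e).

(* Only meaningful for distinct u and v: add_edge e u u has a loop at u. *)
Definition add_edge e u v : rel T :=
  [rel x y | [|| e x y, (x == u) && (y == v) | (x == v) && (y == u)]].

Definition gamma_c_critical (k : nat) e : Prop :=
  [/\ simple_graph e, connected_graph e, gamma_c e = k &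
      forall u v, u != v -> ~~ e u v -> gamma_c (add_edge e u v) < k].

(* Complete subgraphs are represented by their vertex sets. *)
Definition clique e S : bool :=
  [forall x in S, forall y in S, (x != y) ==> e x y].

Lemma gamma_cP e : connected_graph e ->
  (exists S, is_min_cds e S) /\ (forall S, is_cds e S -> gamma_c e <= #|S|).
Proof.
move=> conn_e.
have cdsT : is_cds e [set: T].
  by rewrite /is_cds [connected_in _ _]conn_e andbT; apply/forallP=> v; rewrite inE.
rewrite /is_min_cds /gamma_c; case: arg_minnP => // S cdsS minS.
by split=> //; exists S; rewrite cdsS eqxx.
Qed.

End Graphs.

(* Vertices of G^*: inl (inl tt) is the new vertex x_0, inl (inr (Tagged _ a))
   with tag i : 'I_l is a vertex of the (i+1)-st complete graph, on n i
   vertices, and inr v is a vertex of G. *)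
Definition star_vertex (T : finType) (l : nat) (n : 'I_l -> nat) : finType :=
  ((unit + {i : 'I_l & 'I_(n i)}) + T)%type.

(* star_arc lists each edge in at least one direction. *)
Definition star_arc (T : finType) (e : rel T) (H : {set T}) (l : nat)
    (n : 'I_l -> nat) (a b : star_vertex T n) : bool :=
  match a, b with
  | inl (inl _), inl (inr q) => (tag q : nat) == 0
  | inl (inr p), inl (inr q) =>
      (tag p == tag q) && (p != q) || ((tag p).+1 == tag q)
  | inl (inr p), inr v => ((tag p).+1 == l) && (v \in H)
  | inr u, inr v => e u v
  | _, _ => false
  end.

Definition star_graph (T : finType) (e : rel T) (H : {set T}) (l : nat)
    (n : 'I_l -> nat) : rel (star_vertex T n) :=
  [rel a b | star_arc e H a b || star_arc e H b a].

(* Main.v *)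
Require Import Defs.
From mathcomp Require Import all_boot.
Set Implicit Arguments.
Unset Strict Implicit.
Unset Printing Implicit Defensive.

(** Put x_0 on level 0, G_i on level i and G on level l + 1, so that adjacent
    vertices differ by at most one level. A connected dominating set of G^* meets
    every level 1, ..., l, and its trace on G is a connected dominating set of G:
    a path leaving G leaves and re-enters it through the clique H. Hence it has at
    least k + l vertices. Conversely, a connected dominating set of G that meets H
    extends by one vertex on each of the levels 1, ..., l. For a new edge uv:
    - if u and v lie in G, extend the set given by (b);
    - if u is on level i < l, the edge uv jumps over level i + 1, which needs no
      vertex; (a) lets the extended set contain v;
    - if u is on level l, then v is outside H, and maximality of H gives w in H not
      adjacent to v. Extend the set given by (b) for vw: the path v, u, w replaces
      the edge vw. *)

(** * Paths, connected dominating sets and [gamma_c] in a general graph *)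

Section Graph.
Variable T : finType.
Implicit Types (e : rel T) (S : {set T}).

(** An edge may go to a path, even a trivial one; this is what allows a retraction of [G^*] onto [G]
    that collapses edges. *)
Lemma connect_map (U : finType) (r : rel U) (r' : rel T) (f : U -> T) x y :
  (forall x y, r x y -> connect r' (f x) (f y)) ->
  connect r x y -> connect r' (f x) (f y).
Proof.
move=> rr' /connectP[p]; elim: p x => [|z p IHp] x /= => [_ ->//|/andP[rxz pz] yE].
by apply: connect_trans (rr' _ _ rxz) _; apply: IHp.
Qed.

Lemma connect_exit (r : rel T) (P : pred T) x y :
  connect r x y -> P x -> ~~ P y -> exists a b, [/\ r a b, P a & ~~ P b].
Proof.
move=> /connectP[p]; elim: p x => [|z p IHp] x /= => [_ -> Px /negP[]//|/andP[rxz pz] yE Px Py].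
have [Pz|nPz] := boolP (P z); first exact: IHp pz yE Pz Py.
by exists x, z.
Qed.

Lemma induced_sym e S : symmetric e -> symmetric (induced e S).
Proof. by move=> se x y; rewrite /induced /= se andbCA. Qed.

Lemma connected_in_root e S r : symmetric e -> r \in S ->
  (forall x, x \in S -> connect (induced e S) x r) -> connected_in e S.
Proof.
move=> se rS Sr; apply/andP; split; first by apply/set0Pn; exists r.
apply/forall_inP=> x xS; apply/forall_inP=> y yS; apply: connect_trans (Sr x xS) _.
by rewrite (sym_connect_sym (induced_sym S se)) Sr.
Qed.

Lemma connected_inP e S x y : connected_in e S -> x \in S -> y \in S ->
  connect (induced e S) x y.
Proof.
by case/andP=> _ /forall_inP cS xS yS; move/forall_inP: (cS x xS); apply.
Qed.

Lemma dominatingP e S :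
  reflect (forall v, v \notin S -> exists2 u, u \in S & e v u) (dominating e S).
Proof.
apply: (iffP forallP) => dS v; first by move=> vS; apply/exists_inP/(implyP (dS v)).
by apply/implyP=> vS; apply/exists_inP/dS.
Qed.

(** Lets [gamma_c_le] bound [gamma_c] by the size of any connected dominating set, with no separate
    proof that the graph is connected. *)
Lemma connected_cds e S : symmetric e -> is_cds e S -> connected_graph e.
Proof.
move=> se /andP[/dominatingP dS cS].
have /set0Pn[r rS] : S != set0 by case/andP: cS.
apply: (@connected_in_root _ _ r) => // x _.
have step y : y \in S -> connect (induced e setT) y r.
  move=> yS; apply: connect_sub (connected_inP cS yS rS) => a b /and3P[_ _ eab].
  by apply: connect1; rewrite /induced /= !inE.
have [/step//|/dS[u /step ur exu]] := boolP (x \in S).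
by apply: connect_trans ur; apply: connect1; rewrite /induced /= !inE.
Qed.

Lemma gamma_c_le e S : symmetric e -> is_cds e S -> gamma_c e <= #|S|.
Proof. by move=> se cS; case: (gamma_cP (connected_cds se cS)) => _; apply. Qed.

Lemma add_edge_sym e u v : symmetric e -> symmetric (add_edge e u v).
Proof. by move=> se x y; rewrite /add_edge /= se; congr (_ || _); rewrite orbC andbC [in X in _ || X]andbC. Qed.

Lemma add_edgeC e u v : add_edge e u v =2 add_edge e v u.
Proof. by move=> x y; rewrite /add_edge /= [in X in _ || X]orbC. Qed.

Lemma eq_is_cds e e' S : e =2 e' -> is_cds e S = is_cds e' S.
Proof.
move=> ee'; congr (_ && _).
  by apply/dominatingP/dominatingP => dS v /dS[u uS euv]; exists u; rewrite -?ee' // ee'.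
congr (_ && _); apply: eq_forallb_in => x xS; apply: eq_forallb_in => y yS.
by apply: eq_connect => a b; rewrite /induced /= ee'.
Qed.

End Graph.

(** * Levels and adjacency in [G^*] *)

Section Star.
Variables (T : finType) (e : rel T) (H : {set T}) (l : nat) (n : 'I_l -> nat).
Hypotheses (e_sym : symmetric e) (l_gt0 : 0 < l) (Hclique : clique e H).
Local Notation V := (star_vertex T n).
Local Notation star := (star_graph e H (n := n)).
Local Notation x0 := (inl (inl tt) : V).
Implicit Types (a b u v x y : V) (t h : T) (B : {set T}) (P : nat -> V).

Definition level x : nat :=
  match x with
  | inl (inl _) => 0
  | inl (inr p) => (tag p).+1
  | inr _ => l.+1
  end.

Lemma level_top x : l < level x -> exists t, x = inr t.
Proof. case: x => [[[]|p]|t] //= lx; last by exists t.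
by have := ltn_ord (tag p); rewrite ltnNge -ltnS lx. Qed.

Lemma star_sym : symmetric star.
Proof. by move=> x y; rewrite /star_graph /= orbC. Qed.

Lemma cliqueP t h : t \in H -> h \in H -> t != h -> e t h.
Proof.
move=> tH hH; apply/implyP.
by move/forall_inP: Hclique => /(_ t tH)/forall_inP; apply.
Qed.

Lemma star_inr t h : star (inr t) (inr h) = e t h.
Proof. by rewrite /star_graph /= [e h t]e_sym orbb. Qed.

(** Level 0 is a single vertex and levels 1 to [l] are cliques; the bound excludes level [l.+1],
    which is [G]. *)
Lemma star_same a b : level a = level b -> level b <= l -> a != b -> star a b.
Proof.
rewrite /star_graph; case: a b => [[[]|p]|t] [[[]|q]|h] //=; rewrite ?ltnn //; last by move=> [<-]; rewrite ltnn.
move=> [pq] _ npq; apply/orP; left; apply/orP; left.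
by apply/andP; split; [apply/eqP/val_inj | apply: contraNneq npq => ->].
Qed.

Lemma star_next a b : level b = (level a).+1 -> level b <= l -> star a b.
Proof.
rewrite /star_graph; case: a b => [[[]|p]|t] [[[]|q]|h] //=; rewrite ?ltnn //.
- by move=> [->] _; rewrite eqxx.
- by move=> [->] _; rewrite eqxx orbT.
- by move=> [->]; rewrite ltnNge leqnSn.
Qed.

Lemma star_top a h : level a = l -> h \in H -> star a (inr h).
Proof.
rewrite /star_graph; case: a => [[[]|p]|t] //=; first by have := l_gt0; case: (l).
  by move=> -> ->; rewrite eqxx.
by move/eqP; rewrite eqn_leq ltnn.
Qed.

Lemma star_level a b : star a b -> level b <= (level a).+1.
Proof.
rewrite /star_graph; case: a b => [[[]|p]|t] [[[]|q]|h] //=; rewrite ?orbF //.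
- by move/eqP->.
- case/orP=> [/orP[/andP[/eqP->]//|/eqP->//]|/orP[/andP[/eqP->]//|/eqP<-]].
  by rewrite ltnS -addn2 leq_addr.
- by case/andP=> /eqP->.
- by move=> _; rewrite ltnS; apply: ltnW; apply: ltnW; rewrite ltnS.
Qed.

(** [H] is the only gate into [G], and it opens only onto level [l]. *)
Lemma star_into a h : star a (inr h) -> level a <= l -> level a = l /\ h \in H.
Proof.
rewrite /star_graph; case: a => [[[]|p]|t] //=; rewrite ?ltnn // orbF.
by case/andP=> /eqP.
Qed.

Lemma star_simple : irreflexive e -> simple_graph star.
Proof.
move=> e_irr; split; first exact: star_sym.
rewrite /star_graph => -[[[]|p]|t] //=; last by rewrite e_irr.
by rewrite !eqxx /= orbb; apply/negbTE; rewrite neq_ltn ltnSn orbT.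
Qed.

(** * Lower bound: the levels and the trace on [G] of a connected dominating set of [G^*] *)

Section LowerBound.
Variable D : {set V}.
Hypothesis cdsD : is_cds star D.
Let A := [set t | inr t \in D].

Let domD := dominatingP _ _ (andP cdsD).1.
Let connD := (andP cdsD).2.

Lemma cds_star_connect x y : x \in D -> y \in D -> connect (induced star D) x y.
Proof. exact: connected_inP. Qed.

(** Either [x0] is in [D], or [D] contains a neighbour of [x0], which lies on level 1. *)
Lemma cds_star_low : exists2 x, x \in D & level x <= 1.
Proof.
have [x0D|/domD[u uD /star_level]] := boolP (x0 \in D); first by exists x0.
by exists u.
Qed.

Hypothesis A_neq0 : A != set0.

(** A path in [D] from level at most 1 up to [G] climbs at most one level per edge, so it cannot
    jump over level [i]. *)
Lemma cds_star_meets i : 0 < i <= l -> exists2 x, x \in D & level x = i.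
Proof.
move=> /andP[i_gt0 il]; have [x xD x1] := cds_star_low.
have [xi|ix] := ltnP (level x) i; last first.
  by exists x => //; apply/eqP; rewrite eqn_leq ix andbT (leq_trans x1).
have /set0Pn[t] := A_neq0; rewrite inE => tD.
have [|a [b [/and3P[aD bD /star_level ab] /= ai bi]]] :=
    connect_exit (P := fun x => level x < i) (cds_star_connect xD tD) xi.
  by rewrite /= -leqNgt leqW.
exists b => //; apply/eqP; rewrite eqn_leq (leq_trans ab) //=.
by rewrite leqNgt.
Qed.

Lemma cds_star_meetsH : exists2 h, h \in H & h \in A.
Proof.
have [x xD x1] := cds_star_low; have /set0Pn[t] := A_neq0; rewrite inE => tD.
have [||a [b [/and3P[aD bD ab] /= al]]] :=
    connect_exit (P := fun x => level x <= l) (cds_star_connect xD tD).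
- exact: leq_trans x1 l_gt0.
- by rewrite /= ltnn.
rewrite -ltnNge => /level_top[h bE]; rewrite {}bE in bD ab.
by exists h; rewrite ?inE //; case: (star_into ab al).
Qed.

Lemma cds_star_trace : is_cds e A.
Proof.
have [h hH hA] := cds_star_meetsH; apply/andP; split.
  (* A vertex of [H] is adjacent to [h] by the clique property; a vertex outside [H] has all its
     neighbours in [G]. *)
  apply/dominatingP=> t tA; have [tH|tH] := boolP (t \in H).
    by exists h => //; apply: cliqueP => //; apply: contraNneq tA => ->.
  have [|u uD tu] := domD (v := inr t); first by rewrite inE in tA.
  have [ul|/level_top[r uE]] := leqP (level u) l.
    by rewrite star_sym in tu; case: (star_into tu ul) => _; rewrite (negPf tH).
  by exists r; rewrite ?inE -?star_inr -uE.
(* Everything outside [G] collapses to [h]. An edge crossing the border of [G] has its end in [H],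
   so its image is an edge of the clique [H] or a single vertex. *)
pose retract x := if x is inr t then t else h.
apply: (connected_in_root e_sym hA) => t tA; rewrite inE in tA; rewrite inE in hA.
apply: (connect_map (f := retract) _ (cds_star_connect tA hA)).
have toH s r : s \in H -> r \in H -> s \in A -> r \in A -> connect (induced e A) s r.
  move=> sH rH sA rA; have [->|sr] := eqVneq s r; first exact: connect0.
  by apply: connect1; rewrite /induced /= sA rA cliqueP.
have hA' : h \in A by rewrite inE.
move=> [a|s] [b|r] /and3P[aD bD ab]; rewrite ?connect0 //=.
- have al : level (inl a) <= l by case: (a) => [[]|p] /=.
  by case: (star_into ab al) => _ rH; apply: toH; rewrite ?inE.
- have bl : level (inl b) <= l by case: (b) => [[]|p] /=.
  by rewrite star_sym in ab; case: (star_into ab bl) => _ sH; apply: toH; rewrite ?inE.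
- by rewrite star_inr in ab; apply: connect1; rewrite /induced /= !inE aD bD.
Qed.

(** The vertices of [D] on levels at most [l] realise every level from 1 to [l], and the other ones
    include a copy of [A]. *)
Lemma cds_star_card : #|A| + l <= #|D|.
Proof.
pose L := [set x | level x <= l]; rewrite -(cardsID L D) addnC leq_add //.
  rewrite -[X in X <= _](size_iota 1) cardE -(size_map level).
  apply: uniq_leq_size; rewrite ?iota_uniq // => i; rewrite mem_iota ltnS => il.
  have [x xD xi] := cds_star_meets il; apply/mapP; exists x => //.
  by rewrite mem_enum !inE xD xi; case/andP: il.
have inrI : injective (inr : T -> V) by move=> s t [].
rewrite -(card_imset _ inrI); apply/subset_leq_card/subsetP.
by move=> _ /imsetP[t tA ->]; rewrite inE in tA; rewrite !inE tA /= ltnn.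
Qed.

End LowerBound.

Lemma star_cds_lower D : 1 < gamma_c e -> is_cds star D -> gamma_c e + l <= #|D|.
Proof.
move=> gt1 cdsD.
(* With an empty trace, every vertex of [G] is dominated from level [l] and so lies in [H]. Then [G]
   is complete and [gamma_c e] is at most 1. *)
have An0 : [set t | inr t \in D] != set0.
  apply: contraTneq gt1 => A0; rewrite -leqNgt.
  have HT t : t \in H.
    have tD : inr t \notin D by have := in_set0 t; rewrite -A0 inE => ->.
    have /dominatingP/(_ _ tD)[u uD] := (andP cdsD).1.
    rewrite star_sym => /star_into tu; apply: (proj2 (tu _)).
    rewrite leqNgt; apply/negP=> /level_top[r uE].
    by have := in_set0 r; rewrite -A0 inE -uE uD.
  (* For an empty [T], the set that defines [gamma_c e] has no element either. *)
  have [t _|T0] := pickP (fun _ : T => true); last first.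
    by rewrite (leq_trans (max_card _)) // eq_card0 // => x; have := T0 x.
  rewrite -(cards1 t); apply: gamma_c_le => //; apply/andP; split.
    apply/dominatingP=> v; rewrite inE => vt; exists t; rewrite ?inE //.
    exact: cliqueP.
  apply: (connected_in_root (r := t)) => // [|x]; rewrite !inE //.
  by move/eqP->.
apply: leq_trans (cds_star_card cdsD An0).
by rewrite leq_add2r gamma_c_le // cds_star_trace.
Qed.

(* [B] together with one vertex on each level [1, ..., l] except level [c];
   no level is omitted when [c = 0]. *)
Definition lift_set P c B : {set V} :=
  [set x in map P (rem c (iota 1 l))] :|: [set inr t | t in B].

Lemma mem_lift_inr P c B t : t \in B -> inr t \in lift_set P c B.
Proof. by move=> tB; rewrite !inE imset_f ?orbT. Qed.

Lemma mem_lift_pick P c B i : 0 < i <= l -> i != c -> P i \in lift_set P c B.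
Proof.
move=> il ic; rewrite !inE map_f //.
by rewrite mem_rem_uniq ?iota_uniq // !inE ic mem_iota ltnS.
Qed.

Lemma lift_setP P c B x : x \in lift_set P c B ->
  (exists i, [/\ 0 < i <= l, i != c & x = P i]) \/ (exists2 t, t \in B & x = inr t).
Proof.
rewrite !inE => /orP[/mapP[i]|/imsetP[t]]; last by right; exists t.
rewrite mem_rem_uniq ?iota_uniq // !inE mem_iota ltnS => /andP[ic il] ->.
by left; exists i.
Qed.

(** Only an upper bound: [P] is arbitrary here, so its values may coincide. *)
Lemma card_lift_set0 P B : #|lift_set P 0 B| <= #|B| + l.
Proof.
rewrite (leq_trans (leq_card_setU _ _)) // addnC leq_add ?leq_imset_card //.
by rewrite cardsE (leq_trans (card_size _)) // size_map rem_id ?size_iota // mem_iota.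
Qed.

Lemma card_lift_set P c B : 0 < c <= l -> #|lift_set P c B| < #|B| + l.
Proof.
move=> cl; rewrite (leq_ltn_trans (leq_card_setU _ _)) // addnC.
rewrite -addnS leq_add ?leq_imset_card //.
rewrite cardsE (leq_ltn_trans (card_size _)) // size_map size_rem ?mem_iota //.
by rewrite size_iota prednK.
Qed.

(** * Extending a set of vertices of [G] that meets [H] to a connected dominating set *)

Section Lift.
Variables (E : rel V) (P : nat -> V) (c : nat) (B : {set T}) (h : T).
Hypotheses (E_sym : symmetric E) (starE : subrel star E).
Hypothesis levelP : forall i, i <= l -> level (P i) = i.
Hypotheses (hB : h \in B) (hH : h \in H).
Local Notation D := (lift_set P c B).

Lemma lift_edge x y : x \in D -> y \in D -> E x y -> connect (induced E D) x y.
Proof. by move=> xD yD xy; apply: connect1; rewrite /induced /= xD yD. Qed.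

(** The last condition says that the levels from [i] to [j] avoid the gap [c], so consecutive chosen
    vertices form a path. *)
Lemma lift_chain i j : 0 < i -> i <= j <= l -> (c < i) || (j < c) ->
  connect (induced E D) (P i) (P j).
Proof.
move=> i0; elim: j => [|j IHj] /andP[ij jl] cij; first by rewrite leqNgt i0 in ij.
move: ij; rewrite leq_eqVlt => /orP[/eqP->|ij]; first exact: connect0.
have cD m : i <= m <= j.+1 -> P m \in D.
  move=> /andP[im mj]; apply: mem_lift_pick.
    by rewrite (leq_trans i0) // (leq_trans mj).
  case/orP: cij => [ci|jc]; rewrite neq_ltn; first by rewrite (leq_trans ci im) orbT.
  by rewrite (leq_ltn_trans mj jc).
apply: (connect_trans (IHj _ _)); first by rewrite -ltnS ij ltnW.
  by case/orP: cij => [->//|/ltnW->]; rewrite orbT.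
apply: lift_edge; rewrite ?cD // ?leqnn ?leqnSn ?andbT //; first exact: ltnW.
by apply: starE; apply: star_next; rewrite !levelP // ltnW.
Qed.

Lemma lift_up i : c < i <= l -> connect (induced E D) (P i) (inr h).
Proof.
move=> /andP[ci il]; have i0 := leq_ltn_trans (leq0n c) ci.
apply: (connect_trans (y := P l)); first by apply: lift_chain; rewrite ?il ?ci ?leqnn.
apply: lift_edge; first apply: mem_lift_pick; rewrite ?mem_lift_inr ?l_gt0 ?leqnn //.
  by rewrite neq_ltn (leq_trans ci il) orbT.
by apply: starE; apply: star_top; rewrite ?levelP.
Qed.

Lemma lift_dom_level x i : 0 < i <= l -> i != c -> level x = i -> x \notin D ->
  exists2 u, u \in D & E x u.
Proof.
move=> il ic xi xD; have PD := mem_lift_pick P B il ic; have /andP[_ il'] := il.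
exists (P i) => //; apply: starE; apply: star_same; rewrite ?levelP //.
by apply: contraNneq xD => ->.
Qed.

(** The premises are what depends on [B], on the gap [c] and on new edges of [E]. The other levels
    are cliques containing their chosen vertex, and those above the gap reach [h] by [lift_up]. *)
Lemma lift_cds :
  (forall t, t \notin B -> exists2 u, u \in D & E (inr t) u) ->
  (forall t, t \in B -> connect (induced E D) (inr t) (inr h)) ->
  (exists2 u, u \in D & E x0 u) ->
  (forall x, 0 < c <= l -> level x = c -> exists2 u, u \in D & E x u) ->
  (forall i, 0 < i < c -> i <= l -> connect (induced E D) (P i) (inr h)) ->
  is_cds E D.
Proof.
move=> domB connB dom0 domc connlow; apply/andP; split.
  apply/dominatingP=> x xD.
  have [xl|/level_top[t xE]] := leqP (level x) l; last first.
    by rewrite xE; apply: domB; apply: contra xD; rewrite xE; apply: mem_lift_inr.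
  case: (posnP (level x)) => [|x_gt0]; first by case: x {xD xl} => [[[]|p]|t].
  have xil : 0 < level x <= l by rewrite x_gt0.
  have [xc|xc] := eqVneq (level x) c; first by apply: domc; rewrite -?xc.
  exact: lift_dom_level xil xc _ xD.
apply: (connected_in_root (r := inr h)) => //; first exact: mem_lift_inr.
move=> x /lift_setP[[i [/andP[i0 il] ic ->]]|[t tB ->]]; last exact: connB.
have [ilt|cle] := ltnP i c; first by apply: connlow => //; rewrite i0.
by apply: lift_up; rewrite il andbT ltn_neqAle eq_sym ic.
Qed.

Lemma lift_conn t : is_cds e B -> t \in B -> connect (induced E D) (inr t) (inr h).
Proof.
move=> /andP[_ cB] tB; apply: (connect_map (f := inr) _ (connected_inP cB tB hB)).
move=> r s /and3P[rB sB rs]; apply: lift_edge; rewrite ?mem_lift_inr //.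
by apply: starE; rewrite star_inr.
Qed.

Lemma lift_dom t : is_cds e B -> t \notin B -> exists2 u, u \in D & E (inr t) u.
Proof.
move=> /andP[/dominatingP dB _] /dB[s sB ts]; exists (inr s); first exact: mem_lift_inr.
by apply: starE; rewrite star_inr.
Qed.

End Lift.

Section LiftCds.
Variables (E : rel V) (P : nat -> V) (B : {set T}) (h : T).
Hypotheses (E_sym : symmetric E) (starE : subrel star E).
Hypothesis levelP : forall i, i <= l -> level (P i) = i.
Hypotheses (hB : h \in B) (hH : h \in H).

(** [B] may be connected dominating in a graph [e'] whose edges are not all in [E]: each edge of
    [e'] only has to be simulated in [E], if need be by a detour through a chosen vertex. *)
Lemma lift_all_cds e' : is_cds e' B ->
  (forall t s, s \in B -> e' t s -> exists2 u, u \in lift_set P 0 B & E (inr t) u) ->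
  (forall t s, t \in B -> s \in B -> e' t s ->
    connect (induced E (lift_set P 0 B)) (inr t) (inr s)) ->
  is_cds E (lift_set P 0 B).
Proof.
move=> /andP[/dominatingP dB cB] domB connB.
apply: (lift_cds E_sym starE levelP hB hH) => //; last by move=> i; rewrite ltn0 andbF.
- by move=> t /dB[s sB ts]; apply: domB sB ts.
- move=> t tB; apply: (connect_map (f := inr) _ (connected_inP cB tB hB)).
  by move=> r s /and3P[rB sB rs]; apply: connB.
exists (P 1); first by apply: mem_lift_pick.
by apply: starE; apply: star_next; rewrite levelP.
Qed.

(* The new edge [u v] takes over the role of level [(level u).+1]. *)
Lemma lift_skip_cds u v : level u < l -> (level u).+1 < level v ->
  P (level u) = u -> v \in lift_set P (level u).+1 B -> E u v -> is_cds e B ->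
  is_cds E (lift_set P (level u).+1 B).
Proof.
move=> ul uv Pu vD Euv cB.
(* [x0] is the exception, since level 0 contributes no vertex to the lifted set. *)
have uD : 0 < level u -> u \in lift_set P (level u).+1 B.
  move=> u0; rewrite -{1}Pu; apply: mem_lift_pick; first by rewrite u0 ltnW.
  by rewrite neq_ltn leqnn.
apply: (lift_cds E_sym starE levelP hB hH).
- by move=> t; apply: lift_dom.
- by move=> t; apply: lift_conn.
(* If [u] is [x0], level 1 is the gap and the new edge dominates [x0] by [v]. Otherwise the gap is
   higher and [P 1] is present. *)
- case: (posnP (level u)) => [u0|u_gt0].
    by exists v => //; case: (u) u0 Euv => [[[]|p]|t].
  exists (P 1); first by rewrite mem_lift_pick // neq_ltn ltnS u_gt0.
  by apply: starE; apply: star_next; rewrite levelP.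
(* The gap is dominated from below by [u], or, when [u] is [x0], from above: by [P 2], or by [h] if
   [l] is 1. *)
- move=> x _ xc; case: (posnP (level u)) => [u0|u_gt0]; last first.
    exists u; first exact: uD.
    by apply: starE; rewrite star_sym; apply: star_next; rewrite xc.
  rewrite u0 in xc *; have [l2|l1] := ltnP 1 l.
    exists (P 2); first by rewrite mem_lift_pick.
    by apply: starE; apply: star_next; rewrite levelP // xc.
  exists (inr h); first exact: mem_lift_inr.
  by apply: starE; apply: star_top => //; apply/eqP; rewrite xc eqn_leq l_gt0.
(* Below the gap, climb to [u] and cross to [v], which is a chosen vertex above the gap or a vertex
   of [B]. *)
- move=> i /andP[i0 ic] il; apply: (connect_trans (y := u)).
    by rewrite -{2}Pu; apply: lift_chain; rewrite ?ltnSn ?orbT // -ltnS ic ltnW.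
  apply: (connect_trans (y := v)).
    by apply: lift_edge => //; apply: uD; apply: leq_trans i0 _.
  have [[i' [/andP[_ i'l] _ vE]]|[t tB ->]] := lift_setP vD; last exact: lift_conn.
  by rewrite vE in uv *; apply: lift_up; rewrite // -{1}(levelP i'l) uv.
Qed.

End LiftCds.

(** * Choosing one vertex on each level *)

Section Picks.
Hypothesis n_gt0 : forall i, 0 < n i.

Lemma exists_picks : exists P, forall i, i <= l -> level (P i) = i.
Proof.
(* Index [i] gives level [i.+1]; [x0] is a default for indices that are out of range. *)
pose Q i : V := if insub i is Some j then inl (inr (Tagged _ (Ordinal (n_gt0 j)))) else x0.
exists (fun i => if i is j.+1 then Q j else x0); case=> // i il.
by rewrite /Q insubT.
Qed.

(** Overwriting at two distinct levels creates no conflict. A [v] in [G] changes [P] only at [l.+1],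
    outside the constrained range. *)
Lemma exists_picks_through u v : level u != level v ->
  exists P, [/\ forall i, i <= l -> level (P i) = i, P (level u) = u & P (level v) = v].
Proof.
move=> uv; have [P levelP] := exists_picks.
exists (fun i => if i == level u then u else if i == level v then v else P i); split.
- by move=> i il; case: eqP => [->//|_]; case: eqP => [->//|_]; apply: levelP.
- by rewrite eqxx.
- by rewrite eqxx eq_sym (negPf uv).
Qed.

End Picks.
End Star.

Lemma sub_add_edge (T : finType) (e : rel T) u v : subrel e (add_edge e u v).
Proof. by move=> x y exy; rewrite /add_edge /= exy. Qed.

Lemma add_edge_new (T : finType) (e : rel T) u v : add_edge e u v u v.
Proof. by rewrite /add_edge /= !eqxx orbT. Qed.

(** Otherwise [t |: H] would be a clique strictly larger than [H]. *)
Lemma maxset_clique_nonadjacent (T : finType) (e : rel T) (H : {set T}) t :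
  symmetric e -> maxset (clique e) H -> t \notin H -> exists2 w, w \in H & ~~ e t w.
Proof.
move=> se /maxsetP[/forall_inP cH maxH] tH; apply/exists_inP; apply: contraNT tH.
rewrite negb_exists_in => /forall_inP eH; rewrite -(maxH (t |: H)) ?setU11 ?subsetUr //.
apply/forall_inP=> x xtH; apply/forall_inP=> y ytH; apply/implyP=> xy.
have [xt|xt] := eqVneq x t; have [yt|yt] := eqVneq y t; subst=> //.
- by rewrite eqxx in xy.
- by move: ytH; rewrite !inE (negPf yt) => /eH; rewrite negbK.
- by move: xtH; rewrite !inE (negPf xt) se => /eH; rewrite negbK.
move: xtH ytH; rewrite !inE (negPf xt) (negPf yt) => /cH/forall_inP cx /cx.
by rewrite xy.
Qed.

(** * The value of [gamma_c] on [G^*], then criticality by the level of the lower end of the new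
    edge *)

Theorem theorem5p2 (k l : nat) (hk : 4 <= k) (hl : 1 <= l)
  (T : finType) (e : rel T) (he : gamma_c_critical k e)
  (H : {set T}) (hH : maxset (clique e) H) (hH2 : 2 <= #|H|)
  (ha : forall x : T, exists S : {set T},
      [/\ is_min_cds e S, x \in S & S :&: H != set0])
  (hb : forall u v : T, u != v -> ~~ e u v -> exists D : {set T},
      [/\ is_cds (add_edge e u v) D, D :&: H != set0 & #|D| < k])
  (n : 'I_l -> nat) (hn : forall i, 1 <= n i) :
  gamma_c_critical (k + l) (star_graph e H (n := n)).
Proof.
have [[e_sym e_irr] _ e_k _] := he; have [cliqueH _] := maxsetP hH.
set star := star_graph e H (n := n).
have ssym : symmetric star by apply: star_sym.
have ha' t : exists S h, [/\ is_cds e S, #|S| = k, t \in S, h \in S & h \in H].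
  have [S [/andP[cS /eqP Sk] tS /set0Pn[h /setIP[hS hSH]]]] := ha t.
  by exists S, h; rewrite Sk e_k.
have [z zH] : exists z, z \in H by apply/set0Pn; rewrite -card_gt0 ltnW.
have [S0 [h0 [cS0 S0k _ h0S h0H]]] := ha' z.
have eS t s : e t s -> star (inr t) (inr s) by rewrite /star star_inr.
(* A minimum set [S0] meeting [H], extended by one vertex on each level, gives both the upper bound
   and the connectedness of [G^*]. *)
have [D cD Dk] : exists2 D, is_cds star D & #|D| <= k + l.
  have [P levelP] := exists_picks T hn; exists (lift_set P 0 S0); last first.
    by rewrite -S0k card_lift_set0.
  apply: (lift_all_cds hl ssym (fun _ _ => id) levelP h0S h0H cS0).
    by move=> t s sS ts; exists (inr s); rewrite ?mem_lift_inr ?eS.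
  by move=> t s tS sS ts; apply: lift_edge; rewrite ?mem_lift_inr ?eS.
have star_conn := connected_cds ssym cD.
split=> //; first exact: star_simple.
  apply/eqP; rewrite eqn_leq (leq_trans (gamma_c_le ssym cD) Dk) /=.
  have [[S /andP[cS /eqP <-]] _] := gamma_cP star_conn.
  by rewrite -e_k; apply: star_cds_lower cS; rewrite // e_k (leq_trans _ hk).
(* The new edge is symmetric, so [u] may be taken as the end on the lower level. *)
suff crit u v : u != v -> ~~ star u v -> level u <= level v ->
    exists2 D, is_cds (add_edge star u v) D & #|D| < k + l.
  move=> u v uv nuv.
  have [F cF Fk] : exists2 D, is_cds (add_edge star u v) D & #|D| < k + l.
    have [uv_le|/ltnW vu_le] := leqP (level u) (level v); first exact: crit.
    have [||F cF Fk] := crit v u _ _ vu_le; rewrite 1?eq_sym 1?ssym //.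
    by exists F => //; rewrite (eq_is_cds F (add_edgeC star u v)).
  exact: leq_ltn_trans (gamma_c_le (add_edge_sym u v ssym) cF) Fk.
move=> uv nuv uv_le; set E := add_edge star u v.
have E_sym : symmetric E := add_edge_sym u v ssym.
have starE : subrel star E := @sub_add_edge _ star u v.
have eE t s : e t s -> E (inr t) (inr s) by move/eS/starE.
have Euv : E u v := add_edge_new star u v.
have [ul|lu|ul] := ltngtP (level u) l.
(* Below level [l], vertices on equal or consecutive levels are adjacent, so a missing edge jumps
   over at least one level. *)
- have uv_lt : (level u).+1 < level v.
    rewrite ltn_neqAle [X in _ && X]ltn_neqAle uv_le andbT.
    have [lv|lv] := ltnP l (level v).
      by rewrite !neq_ltn !(leq_ltn_trans _ lv) // ltnW.
    apply/andP; split; apply: contraNneq nuv => uvE.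
      by apply: star_next; rewrite ?uvE.
    exact: star_same.
  have [P [levelP Pu Pv]] := exists_picks_through hn (n := n) (negbT (ltn_eqF (ltnW uv_lt))).
  (* For [v] in [G], (a) provides a set through [v]; otherwise [v] is the chosen vertex of its own
     level, which is not the gap. *)
  have [S [h [cS Sk hS hSH vD]]] : exists S h,
      [/\ is_cds e S, #|S| = k, h \in S, h \in H & v \in lift_set P (level u).+1 S].
    have [lv|/level_top[t vE]] := leqP (level v) l; last first.
      have [S [h [cS Sk tS hS hSH]]] := ha' t.
      by exists S, h; split; rewrite // vE mem_lift_inr.
    exists S0, h0; split=> //; rewrite -{1}Pv; apply: mem_lift_pick.
      by rewrite lv (leq_trans _ uv_lt).
    by rewrite neq_ltn uv_lt orbT.
  exists (lift_set P (level u).+1 S); last by rewrite -Sk card_lift_set.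
  exact: (lift_skip_cds e_sym hl E_sym starE levelP hS hSH ul uv_lt Pu vD Euv cS).
- have [t uE] := level_top lu; have [s vE] := level_top (leq_trans lu uv_le).
  have [|| B [cB /set0Pn[h /setIP[hB hBH]] Bk]] := hb t s.
  + by apply: contraNneq uv => ts; rewrite uE vE ts.
  + by apply: contraNN nuv => ts; rewrite uE vE /star star_inr.
  have [P levelP] := exists_picks T hn; exists (lift_set P 0 B); last first.
    by rewrite (leq_ltn_trans (card_lift_set0 _ _)) // ltn_add2r.
  have addE r w : add_edge e t s r w -> E (inr r) (inr w).
    case/or3P=> [|/andP[/eqP-> /eqP->]|/andP[/eqP-> /eqP->]]; first exact: eE.
      by rewrite -uE -vE.
    by rewrite E_sym -uE -vE.
  apply: (lift_all_cds hl E_sym starE levelP hB hBH cB).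
    by move=> r w wB rw; exists (inr w); rewrite ?mem_lift_inr ?addE.
  by move=> r w rB wB rw; apply: lift_edge; rewrite ?mem_lift_inr ?addE.
(* From here on [u] is on level [l], a clique, so [v] is in [G]; being non-adjacent to [u], it is
   outside [H]. *)
have lv : l < level v.
  rewrite ltnNge; apply: contra nuv => vl; apply: star_same => //.
  by apply/eqP; rewrite eqn_leq uv_le ul.
have [t vE] := level_top lv.
have tH : t \notin H by apply: contra nuv => tH; rewrite vE; apply: star_top.
have [w wH ntw] := maxset_clique_nonadjacent e_sym hH tH.
have [|B [cB /set0Pn[h /setIP[hB hBH]] Bk]] := hb t w _ ntw.
  by apply: contraNneq tH => ->.
have [|P [levelP Pu _]] := exists_picks_through hn (n := n) (u := u) (v := v).
  by rewrite ul neq_ltn lv.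
exists (lift_set P 0 B); last first.
  by rewrite (leq_ltn_trans (card_lift_set0 _ _)) // ltn_add2r.
have uD : u \in lift_set P 0 B.
  by rewrite -Pu ul; apply: mem_lift_pick; rewrite ?leqnn ?andbT // -lt0n.
have Etu : E (inr t) u by rewrite -vE E_sym.
have Euw : E u (inr w) by apply: starE; apply: star_top.
(* Edges of [e] persist in [E]. The edge [t w], absent from [G], is simulated by the new edge from
   [t] to [u] and the edge from [u] to [w] in [H]; [u] is the chosen vertex of level [l]. *)
apply: (lift_all_cds hl E_sym starE levelP hB hBH cB).
  move=> r s sB /or3P[rs|/andP[/eqP-> _]|/andP[/eqP-> _]].
  - by exists (inr s); rewrite ?mem_lift_inr ?eE.
  - by exists u.
  - by exists u; rewrite // E_sym.
move=> r s rB sB /or3P[rs|/andP[/eqP rE /eqP sE]|/andP[/eqP rE /eqP sE]].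
- by apply: lift_edge; rewrite ?mem_lift_inr ?eE.
- apply: (connect_trans (y := u)); apply: lift_edge; rewrite ?mem_lift_inr //.
    by rewrite rE.
  by rewrite sE.
- apply: (connect_trans (y := u)); apply: lift_edge; rewrite ?mem_lift_inr //.
    by rewrite rE E_sym.
  by rewrite sE E_sym.
Qed.
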